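(* For the operad $\mathrm{As}^2$ of two compatible associative products, the following identities hold: $$f_{\mathrm{As}^2}(x)=\sum_{n\ge1}c_nx^n,$$ $$F_{\mathrm{As}^2}(p_1,p_2,\ldots)=\sum_{n\ge1}c_np_1^n,$$ $$F_{\mathrm{As}^2}(p_1,p_2,\ldots;q)=\sum_{n\ge1}p_1^n\sum_{k=0}^{n-1}N_{n,k}\,q^{n-1-2k},$$ where $c_n=\frac{1}{n+1}\binom{2n}{n}$ are the Catalan numbers and $N_{n,k}=\frac1n\binom nk\binom n{k+1}$ are the Narayana numbers (so $N_{n,0}=1$).
   Context: Work over a field $\Bbbk$ of characteristic zero. An algebra with two compatible associative products is a (not necessarily unital) vector space with two bilinear operations $\star_1,\star_2$ such that each is associative, $(a\star_i b)\star_i c=a\star_i(b\star_i c)$ for $i=1,2$, and $$(a\star_1 b)\star_2 c+(a\star_2 b)\star_1 c=a\star_1 (b\star_2 c)+a\star_2 (b\star_1 c)$$ (equivalently, every linear combination of $\star_1,\star_2$ is associative). The operad $\mathrm{As}^2$ is the operad (with $\mathrm{As}^2(1)=\Bbbk$) generated by two binary operations $\star_1,\star_2$ without symmetry, subject to exactly these relations. Its component $\mathrm{As}^2(n)$ is the multilinear part (the span of elements in which each generator occurs exactly once) of the free algebra with two compatible associative products on $n$ generators $a_1,\dots,a_n$; the symmetric group $S_n$ acts by permuting the generators. The group $SL_2$ acts on $\mathrm{As}^2$ by operad automorphisms: it acts on the two-dimensional span of $\star_1,\star_2$ as on its standard two-dimensional representation (the relations are preserved), and this action commutes with the $S_n$-actions.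 Generating functions: $f_{\mathrm{As}^2}(x)=\sum_{n\ge1}\frac{\dim \mathrm{As}^2(n)}{n!}x^n$. $F_{\mathrm{As}^2}(p_1,p_2,\dots)=\sum_{n\ge1}F_{\mathrm{As}^2(n)}$, where for an $S_n$-module $M$ with character $\chi_M$ one sets $F_M=\frac1{n!}\sum_{\sigma\in S_n}\chi_M(\sigma)\prod_{i\ge 1}p_i^{n_i(\sigma)}$, with $n_i(\sigma)$ the number of cycles of length $i$ of $\sigma$ (here $p_i$ are the Newton power sums, viewed as independent variables). $F_{\mathrm{As}^2}(p_1,p_2,\dots;q)$ is defined in the same way, with $\chi_M(\sigma)$ replaced by the trace of the pair $(\sigma,\mathrm{diag}(q,q^{-1}))\in S_n\times SL_2$, a Laurent polynomial in $q$. *)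

(* Defs.v *)
From HB Require Import structures.
From mathcomp Require Import all_boot all_order all_algebra all_fingroup.
From mathcomp Require Import mxrepresentation fraction finmap monalg.

Set Implicit Arguments.
Unset Strict Implicit.
Unset Printing Implicit Defensive.

Import GRing.Theory.
Local Open Scope ring_scope.

(* Monomials in the free algebra with two binary operations (no relations) on
   the generators T.  The operations star_1, star_2 are indexed by 0, 1 : 'I_2. *)
Inductive tree (T : Type) : Type :=
  | Leaf of T
  | Node of 'I_2 & tree T & tree T.
Arguments Leaf {T}.
Arguments Node {T}.

Section Trees.
Variable T : Type.
Implicit Types t : tree T.

Fixpoint leaves t : seq T :=
  match t with
  | Leaf a => [:: a]
  | Node _ l r => leaves l ++ leaves r
  end.

Fixpoint tree_map (U : Type) (f : T -> U) t : tree U :=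
  match t with
  | Leaf a => Leaf (f a)
  | Node j l r => Node j (tree_map f l) (tree_map f r)
  end.

Fixpoint tree_code t : seq ('I_2 + T) :=
  match t with
  | Leaf a => [:: inr a]
  | Node j l r => inl j :: tree_code l ++ tree_code r
  end.

Definition tree_push (x : 'I_2 + T) (s : seq (tree T)) : seq (tree T) :=
  match x, s with
  | inr a, _ => Leaf a :: s
  | inl j, l :: r :: s' => Node j l r :: s'
  | inl _, _ => s
  end.

Definition tree_decode (s : seq ('I_2 + T)) : option (tree T) :=
  ohead (foldr tree_push [::] s).

Lemma tree_codeK : pcancel tree_code tree_decode.
Proof.
move=> t; rewrite /tree_decode -[tree_code t]cats0.
suff H s : foldr tree_push [::] (tree_code t ++ s) =
           t :: foldr tree_push [::] s by rewrite H.
by elim: t s => [a|j l IHl r IHr] s //=; rewrite -catA IHl IHr.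
Qed.

Lemma size_tree_code t : size (tree_code t) = (size (leaves t)).*2.-1.
Proof.
have pos u : (0 < size (leaves u))%N.
  by elim: u => //= j l Hl r Hr; rewrite size_cat addn_gt0 Hl.
elim: t => //= j l IHl r IHr; rewrite !size_cat IHl IHr doubleD.
case: (size (leaves l)) (pos l) => // x _.
case: (size (leaves r)) (pos r) => // y _.
by rewrite !doubleS /= !addnS.
Qed.

End Trees.

HB.instance Definition _ (T : eqType) :=
  Equality.copy (tree T) (pcan_type (@tree_codeK T)).
HB.instance Definition _ (T : choiceType) :=
  Choice.copy (tree T) (pcan_type (@tree_codeK T)).
HB.instance Definition _ (T : countType) :=
  Countable.copy (tree T) (pcan_type (@tree_codeK T)).

(* The multilinear monomials in a_0, ..., a_(n-1): each generator occurs
   exactly once.  They form a basis of the n-th component of the free operad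
   on two binary operations without symmetry. *)
Record mtree (n : nat) : Type := MTree {
  mtree_val :> tree 'I_n;
  mtreeP : perm_eq (leaves mtree_val) (enum 'I_n)
}.
HB.instance Definition _ n := [isSub for @mtree_val n].
HB.instance Definition _ n := [Choice of mtree n by <:].
HB.instance Definition _ n := [Countable of mtree n by <:].

Section MtreeFinite.
Variable n : nat.

Lemma mtree_code_size (t : mtree n) :
  size (tree_code (mtree_val t)) == n.*2.-1.
Proof. by rewrite size_tree_code (perm_size (mtreeP t)) size_enum_ord. Qed.

Definition mtree_code (t : mtree n) : n.*2.-1.-tuple ('I_2 + 'I_n)%type :=
  Tuple (mtree_code_size t).

Definition mtree_decode (s : n.*2.-1.-tuple ('I_2 + 'I_n)%type) :
  option (mtree n) := obind insub (tree_decode s).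

Lemma mtree_codeK : pcancel mtree_code mtree_decode.
Proof. by move=> t; rewrite /mtree_decode /= tree_codeK /= valK. Qed.

HB.instance Definition _ := isFinite.Build (mtree n)
  (pcan_enumP mtree_codeK).
End MtreeFinite.

Section Operad.
Variable T : Type.

(* A formal integral combination of monomials. *)
Definition comb := seq (int * tree T).

Definition assoc_rel (i : 'I_2) (a b c : tree T) : comb :=
  [:: (1, Node i (Node i a b) c); (-1, Node i a (Node i b c))].

Definition compat_rel (a b c : tree T) : comb :=
  [:: (1, Node 1 (Node 0 a b) c); (1, Node 0 (Node 1 a b) c);
      (-1, Node 0 a (Node 1 b c)); (-1, Node 1 a (Node 0 b c))].

Definition comb_map (f : tree T -> tree T) (r : comb) : comb :=
  [seq (x.1, f x.2) | x <- r].

(* Every consequence of a defining relation, i.e. the relation for some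
   monomials a, b, c plugged into a monomial with a hole, has a term in which
   the hole is filled by (a * b) * c.  [relators t] lists the consequences
   having t as such a term. *)
Fixpoint relators (t : tree T) : seq comb :=
  match t with
  | Leaf _ => [::]
  | Node j l r =>
      match l with
      | Leaf _ => [::]
      | Node i a b =>
          [:: if i == j then assoc_rel i a b r else compat_rel a b r]
      end
      ++ [seq comb_map (fun u => Node j u r) c | c <- relators l]
      ++ [seq comb_map (fun u => Node j l u) c | c <- relators r]
  end.

End Operad.

Section As2.
Variables (k : fieldType) (n : nat).

(* The n-th component of the free operad is 'rV[k]_(fdim n), with basis the
   multilinear monomials; linear maps act on row vectors from the right. *)
Definition fdim : nat := #|{: mtree n}|.

Definition monom (i : 'I_fdim) : tree 'I_n :=
  mtree_val (enum_val i : mtree n).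

Definition monom_vec (t : tree 'I_n) : 'rV[k]_fdim :=
  \row_i (monom i == t)%:R.

Definition comb_vec (r : comb 'I_n) : 'rV[k]_fdim :=
  \sum_(x <- r) x.1%:~R *: monom_vec x.2.

(* The n-th component of the operadic ideal generated by the relations. *)
Definition ideal : 'M[k]_fdim :=
  (\sum_(t : mtree n) \sum_(r <- relators (mtree_val t)) <<comb_vec r>>)%MS.

(* As^2(n) is the quotient of 'rV[k]_fdim by the row space of [ideal], in the
   coordinates of [in_factmod] and [val_factmod]. *)
Definition as2_dim : nat := \rank (cokermx ideal).

(* The endomorphism of As^2(n) induced by an endomorphism of 'rV[k]_fdim
   which preserves [ideal]. *)
Definition as2_mx (f : 'M[k]_fdim) : 'M[k]_as2_dim :=
  in_factmod ideal (val_factmod 1%:M *m f).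

Definition perm_act (s : 'S_n) : 'M[k]_fdim :=
  \matrix_(i, j) (monom j == tree_map s (monom i))%:R.

(* Coefficient of u in g.t, where g acts on the span of star_1, star_2 by
   star_i |-> \sum_j g j i star_j, and on monomials as an operad
   automorphism of the free operad. *)
Fixpoint gl_coef (g : 'M[k]_2) (t u : tree 'I_n) : k :=
  match t, u with
  | Leaf a, Leaf b => (a == b)%:R
  | Node i l r, Node j l' r' => g j i * gl_coef g l l' * gl_coef g r r'
  | _, _ => 0
  end.

Definition gl_act (g : 'M[k]_2) : 'M[k]_fdim :=
  \matrix_(i, j) gl_coef g (monom i) (monom j).

Definition as2_char (s : 'S_n) : k := \tr (as2_mx (perm_act s)).

Definition as2_char_SL2 (s : 'S_n) (g : 'M[k]_2) : k :=
  \tr (as2_mx (perm_act s *m gl_act g)).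

Definition torus (q : k) : 'M[k]_2 :=
  diag_mx (\row_i if i == 0 then q else q^-1).

End As2.

(* [fsum u S]: the formal series with coefficients S is \sum_(n >= 1) u n,
   where u n is given by its coefficients and the sum is locally finite. *)
Definition fsum (I : Type) (V : nmodType) (u : nat -> I -> V) (S : I -> V) :=
  forall m : I, exists N : nat, forall M : nat,
    (N <= M)%N -> \sum_(1 <= n < M) u n m = S m.

(* \sum_(n >= 1) u n = \sum_(n >= 1) v n, both sums being well defined. *)
Definition fsum_eq (I : Type) (V : nmodType) (u v : nat -> I -> V) :=
  exists S : I -> V, fsum u S /\ fsum v S.

(* Polynomials in the independent variables p_i; only i >= 1 is used. *)
Definition ppoly (A : fieldType) := {malg A[{cmonom nat}]}.

Definition p_ (A : fieldType) (i : nat) : ppoly A := << ucm i >>.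

Definition pcoef (A : fieldType) (F : ppoly A) : {cmonom nat} -> A :=
  fun m => F@_m.

Definition ncycles (n : nat) (s : 'S_n) (i : nat) : nat :=
  #|[set C in porbits s | #|C| == i]|.

Definition frob (A : fieldType) (n : nat) (chi : 'S_n -> A) : ppoly A :=
  (n`!%:R)^-1 *:
    \sum_(s : 'S_n) chi s *: \prod_(1 <= i < n.+1) p_ A i ^+ ncycles s i.

(* Laurent polynomials over k, as finitely supported functions int -> k;
   [lval f q L] is the value of L at q, with coefficients sent along f. *)
Definition laurent (k : fieldType) := {malg k[int]}.

Definition lval (k A : fieldType) (f : k -> A) (q : A) (L : laurent k) : A :=
  \sum_(j <- msupp L) f L@_j * q ^ j.

(* The field k(q), which contains the ring of Laurent polynomials. *)
Definition ratfun (k : fieldType) : fieldType := {fraction {poly k}}.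

Definition rf_const (k : fieldType) (c : k) : ratfun k := tofrac c%:P.

Definition rf_q (k : fieldType) : ratfun k := tofrac 'X.

Definition laurent_rf (k : fieldType) (L : laurent k) : ratfun k :=
  lval (@rf_const k) (rf_q k) L.

Definition catalan (A : fieldType) (n : nat) : A :=
  (n.+1%:R)^-1 * 'C(n.*2, n)%:R.

Definition narayana (A : fieldType) (n j : nat) : A :=
  (n%:R)^-1 * 'C(n, j)%:R * 'C(n, j.+1)%:R.

(* Main.v *)
Require Import Defs.
From HB Require Import structures.
From mathcomp Require Import all_boot all_order all_algebra all_fingroup.
From mathcomp Require Import mxrepresentation fraction finmap monalg.
From mathcomp Require Import zify ring.

(** The two products are written *0 and *1.  Adjoin to the free algebra with
    two compatible associative products a unit common to *0 and *1; the
    relations stay consistent when some of the arguments equal this unit.  The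
    idea is that the resulting algebra has as a basis the elements
      (a *1 u) *0 v,   a a generator, u and v basis elements or the unit,
    that is, the binary trees [Branch a u v] whose nodes are labelled by
    generators, the empty tree being the unit.

    If these normal forms span, then the relations leave no choice for the
    products: with x = Branch a u v, that is x = (a *1 u) *0 v,
      x *0 y = Branch a u (v *0 y),
      x *1 y = Branch a u (v *1 y) + Branch a (u *1 (v *0 y)) Empty
               - Branch a (u *1 v) y,
    where the second line is the compatibility relation for a *1 u, v, y.
    Conversely these recursive formulas define two products on the free
    abelian group on binary trees, and an induction on the left factor proves
    that both are associative and that they are compatible ([star0A],
    [star1A], [star_compat]).  Evaluating a monomial in this algebra therefore
    kills every relation ([nf_respects]) and fixes the normal forms
    ([onf_realize]), so the normal forms are linearly independent in the
    operad.  They span because the formulas are consequences of the relations: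
    a function on monomials that respects the relations takes on each monomial
    the value prescribed by its normal form ([reduce]).

    So As^2(n) has as a basis the binary trees whose word of labels, read in
    prefix order, is a permutation of a_1, ..., a_n.  The symmetric group
    permutes this basis freely, and the torus acts on each basis element by a
    power of q.  Hence the character vanishes except at the identity
    ([twist_trace]), where it equals n! times the sum of
    q^(n - 1 - 2 k) over the binary trees with n unlabelled nodes, k being the
    number of products *1.  A character supported at the identity gives a
    multiple of p_1^n ([frob_regular]).

    It remains to count binary trees by k, the number of nonempty subtrees in
    the position u.  A tree is built from a stack of empty slots of the two
    kinds u and v: the first slot is either left empty, or filled by a node,
    which creates two new slots, one of each kind.  For forests filling p
    slots of kind v and r slots of kind u by j nodes in the first kind and k
    nodes in the second, where n = j + k, the count is the 2 x 2 determinant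
      C(n+p-1, j) C(n+r-1, k) - C(n+p-1, j-1) C(n+r-1, k-1),
    because it satisfies the same recursion, by Pascal's rule
    ([forest_countE]).  The case of one slot of kind v gives the Narayana
    numbers, and Vandermonde's identity sums them to the Catalan numbers. *)

Set Implicit Arguments.
Unset Strict Implicit.
Unset Printing Implicit Defensive.

Import GRing.Theory.
Local Open Scope ring_scope.

(** * Free abelian groups *)

(** The free abelian group on K, known through its coordinates: all that follows
    depends on these properties and on no particular construction. *)
Record free_abelian_group (K : choiceType) := FreeAbelianGroup {
  free_sort :> zmodType;
  basis : K -> free_sort;
  coef : K -> free_sort -> int;
  supp : free_sort -> seq K;
  coef_is_additive : forall x, additive (coef x);
  coef_basis : forall x y, coef x (basis y) = (x == y)%:R;
  supp_uniq : forall g, uniq (supp g);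
  coef_supp : forall g x, x \notin supp g -> coef x g = 0;
  basis_expansion : forall g, g = \sum_(x <- supp g) basis x *~ coef x g
}.

Fact free_abelian (K : choiceType) : free_abelian_group K.
Proof.
pose c x (g : {malg int[K]}) := g@_x.
apply: (@FreeAbelianGroup K {malg int[K]} (fun x => << x >>) c (fun g => msupp g)).
- by move=> x; apply: raddfB.
- by move=> x y; rewrite /c mcoeffU eq_sym; case: eqP.
- by move=> g; apply: fset_uniq.
- by move=> g x; apply: mcoeff_outdom.
move=> g; rewrite [LHS]monalgE; apply: eq_bigr => x _.
apply/malgP => y; rewrite /c raddfMz /= !mcoeffU.
by case: eqP => _; rewrite ?mulr1n ?mulr0n ?mul0rz ?intz.
Qed.

Local Notation Free K := (free_sort (free_abelian K)).
Local Notation gen := (basis (free_abelian _)).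

HB.instance Definition _ (K : choiceType) (x : K) :=
  GRing.isAdditive.Build (Free K) int (coef x) (coef_is_additive x).

Section Extension.
Variables (K : choiceType) (V : zmodType).
Implicit Types (f : K -> V) (g : Free K).

Definition extend f g : V := \sum_(x <- supp g) f x *~ coef x g.

(** A nonzero coefficient outside d is harmless where f vanishes.  This is how
    non-multilinear monomials disappear when f sends them to 0. *)
Lemma extendEw f g (d : seq K) :
  uniq d -> (forall x, x \notin d -> f x *~ coef x g = 0) ->
  extend f g = \sum_(x <- d) f x *~ coef x g.
Proof.
move=> ud hd; pose e := [seq x <- d | x \in supp g].
have -> : \sum_(x <- d) f x *~ coef x g = \sum_(x <- e) f x *~ coef x g.
  rewrite big_filter [RHS]big_mkcond /=; apply: eq_bigr => x _.
  by case: ifPn => // /coef_supp->; rewrite mulr0z.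
rewrite /extend (bigID (mem d)) /= [X in _ + X]big1 ?addr0 => [|x /hd //].
rewrite -big_filter; apply: perm_big; apply: uniq_perm.
- exact/filter_uniq/supp_uniq.
- exact: filter_uniq.
by move=> x; rewrite !mem_filter andbC.
Qed.

Lemma extend_is_additive f : additive (extend f).
Proof.
move=> g h; pose d := undup (supp g ++ supp h ++ supp (g - h)).
have out (e : Free K) x : {subset supp e <= d} ->
    x \notin (d : seq K) -> f x *~ coef x e = 0.
  by move=> sed xd; rewrite coef_supp ?mulr0z //; apply: contra xd => /sed.
rewrite !(@extendEw f _ d) ?undup_uniq // => [|x|x|x].
- by rewrite -sumrB; apply: eq_bigr => x _; rewrite raddfB mulrzBr.
all: by apply: out => y; rewrite mem_undup !mem_cat => ->; rewrite ?orbT.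
Qed.

HB.instance Definition _ f :=
  GRing.isAdditive.Build (Free K) V (extend f) (extend_is_additive f).

Lemma extend_gen f x : extend f (gen x) = f x.
Proof.
rewrite (@extendEw f _ [:: x]) ?big_seq1 ?coef_basis ?eqxx ?mulr1z // => y.
by rewrite inE coef_basis => /negbTE->; rewrite mulr0z.
Qed.

Lemma eq_extend f1 f2 : f1 =1 f2 -> extend f1 =1 extend f2.
Proof. by move=> e g; apply: eq_bigr => x _; rewrite e. Qed.

Lemma extendD f1 f2 g : extend (fun x => f1 x + f2 x) g = extend f1 g + extend f2 g.
Proof. by rewrite -big_split; apply: eq_bigr => x _; rewrite mulrzDl. Qed.

Lemma extendB f1 f2 g : extend (fun x => f1 x - f2 x) g = extend f1 g - extend f2 g.
Proof. by rewrite -sumrB; apply: eq_bigr => x _; rewrite mulrzBl. Qed.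

End Extension.

Lemma extend_exchange (K L : choiceType) (V : zmodType) (f : K -> L -> V) g h :
  extend (fun x => extend (f x) h) g = extend (fun y => extend (f ^~ y) g) h.
Proof.
rewrite /extend; under eq_bigr do rewrite mulrz_suml.
rewrite exchange_big; apply: eq_bigr => y _; rewrite mulrz_suml.
by apply: eq_bigr => x _; rewrite mulrzAC.
Qed.

Lemma raddf_extend (K : choiceType) (V W : zmodType) (h : {additive V -> W})
    (f : K -> V) g : h (extend f g) = extend (h \o f) g.
Proof. by rewrite raddf_sum; apply: eq_bigr => x _; rewrite raddfMz. Qed.

Lemma free_ind (K : choiceType) (P : Free K -> Prop) :
  P 0 -> (forall g h, P g -> P h -> P (g - h)) -> (forall x, P (gen x)) ->
  forall g, P g.
Proof.
move=> P0 PB PU g; have PN h : P h -> P (- h) by rewrite -[- h]add0r; apply: PB.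
have PD g1 g2 : P g1 -> P g2 -> P (g1 + g2).
  by move=> P1 P2; rewrite -[g2]opprK; apply: PB => //; apply: PN.
have PM h n : P h -> P (h *+ n).
  by move=> Ph; elim: n => [|n IH]; rewrite ?mulr0n // mulrS; apply: PD.
rewrite [g]basis_expansion; apply: big_ind => // x _.
case: (coef x g) => n; first exact: PM (PU x).
by rewrite NegzE mulrNz; apply/PN/PM.
Qed.

(** * The free algebra with two compatible products *)

Lemma addrB3 (V : zmodType) (a b c a' b' c' : V) :
  (a - a') + (b - b') - (c - c') = a + b - c - (a' + b' - c').
Proof.
by rewrite addrACA -opprD !opprB addrACA [RHS]addrACA [- c - _]addrC.
Qed.

Lemma addr_compat (V : zmodType) (p q r s t w e : V) : p + t = q + r ->
  p + s - w + (t + w - e) = q + (r + s - e).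
Proof.
by move=> pq; rewrite [t + w]addrC -!addrA addKr (addrCA s) !addrA -pq.
Qed.

Lemma addr_assoc1 (V : zmodType) (p s r m n e f x : V) : n + s = x + f ->
  p + s - r + (m + n - m) - (e + f - r) = p + x - e.
Proof.
move=> ns; rewrite [m + n]addrC addrK opprB addrACA addrNK.
by rewrite -addrA (addrA s) [s + n]addrC ns [e + f]addrC opprD (addrA (x + f)) addrK addrA.
Qed.

(** [Branch a u v] stands for (a *1 u) *0 v and [Empty] for the common unit. *)
Inductive btree (T : Type) : Type :=
  | Empty
  | Branch of T & btree T & btree T.
Arguments Empty {T}.
Arguments Branch {T}.

Section BtreeChoice.
Variable T : Type.

Fixpoint btree_code (x : btree T) : GenTree.tree T :=
  match x with
  | Empty => GenTree.Node 0 [::]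
  | Branch a u v => GenTree.Node 1 [:: GenTree.Leaf a; btree_code u; btree_code v]
  end.

Fixpoint btree_decode (c : GenTree.tree T) : option (btree T) :=
  match c with
  | GenTree.Node 1 [:: GenTree.Leaf a; c1; c2] =>
      if (btree_decode c1, btree_decode c2) is (Some u, Some v)
      then Some (Branch a u v) else None
  | _ => Some Empty
  end.

Lemma btree_codeK : pcancel btree_code btree_decode.
Proof. by elim=> //= a u -> v ->. Qed.

End BtreeChoice.

HB.instance Definition _ (T : eqType) :=
  Equality.copy (btree T) (pcan_type (@btree_codeK T)).
HB.instance Definition _ (T : choiceType) :=
  Choice.copy (btree T) (pcan_type (@btree_codeK T)).

Section Algebra.
Variable T : choiceType.
Implicit Types (x u v : btree T) (a : T) (i j : 'I_2).
Local Notation A := (Free (btree T)).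
Implicit Types g h y z : A.

Definition graft a g h : A := extend (fun u => extend (fun v => gen (Branch a u v)) h) g.

Lemma graft_gen a u v : graft a (gen u) (gen v) = gen (Branch a u v).
Proof. by rewrite /graft !extend_gen. Qed.

Lemma graft0l a h : graft a 0 h = 0. Proof. exact: raddf0. Qed.
Lemma graftBl a g1 g2 h : graft a (g1 - g2) h = graft a g1 h - graft a g2 h.
Proof. exact: raddfB. Qed.
Lemma graftDl a g1 g2 h : graft a (g1 + g2) h = graft a g1 h + graft a g2 h.
Proof. exact: raddfD. Qed.
Lemma graft_is_additive a g : additive (graft a g).
Proof.
move=> h1 h2; rewrite /graft -extendB.
by apply: eq_extend => u; rewrite raddfB.
Qed.
HB.instance Definition _ a g :=
  GRing.isAdditive.Build A A (graft a g) (graft_is_additive a g).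

Lemma graft0r a g : graft a g 0 = 0. Proof. exact: raddf0. Qed.
Lemma graftBr a g h1 h2 : graft a g (h1 - h2) = graft a g h1 - graft a g h2.
Proof. exact: raddfB. Qed.
Lemma graftDr a g h1 h2 : graft a g (h1 + h2) = graft a g h1 + graft a g h2.
Proof. exact: raddfD. Qed.

(** The products of a tree by an arbitrary element.  With the factor on the
    right already an element of the group, nested products such as
    u *1 (v *0 y) keep the recursion structural. *)
Fixpoint lstar0 x y : A :=
  if x is Branch a u v then graft a (gen u) (lstar0 v y) else y.

Fixpoint lstar1 x y : A :=
  if x is Branch a u v then
    graft a (gen u) (lstar1 v y) + graft a (lstar1 u (lstar0 v y)) (gen Empty)
    - graft a (lstar1 u (gen v)) y
  else y.

Definition lstar j := if j == 0 then lstar0 else lstar1.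

Definition star j g y : A := extend (lstar j ^~ y) g.

Lemma lstar0_is_additive x : additive (lstar0 x).
Proof. by elim: x => //= a u _ v IHv y z; rewrite IHv graftBr. Qed.

Lemma lstar1_is_additive x : additive (lstar1 x).
Proof.
elim: x => //= a u IHu v IHv y z; rewrite IHv lstar0_is_additive IHu !(graftBl, graftBr).
exact: addrB3.
Qed.

Lemma star_is_additive j g : additive (star j g).
Proof.
move=> y z; rewrite /star -extendB; apply: eq_extend => x; rewrite /lstar.
by case: ifP => _; rewrite ?lstar0_is_additive ?lstar1_is_additive.
Qed.
HB.instance Definition _ j g :=
  GRing.isAdditive.Build A A (star j g) (star_is_additive j g).

Lemma star0l j h : star j 0 h = 0. Proof. exact: raddf0. Qed.
Lemma starBl j g1 g2 h : star j (g1 - g2) h = star j g1 h - star j g2 h.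
Proof. exact: raddfB. Qed.
Lemma star0r j g : star j g 0 = 0. Proof. exact: raddf0. Qed.
Lemma starBr j g h1 h2 : star j g (h1 - h2) = star j g h1 - star j g h2.
Proof. exact: raddfB. Qed.
Lemma starDr j g h1 h2 : star j g (h1 + h2) = star j g h1 + star j g h2.
Proof. exact: raddfD. Qed.
Lemma starDl j g1 g2 h : star j (g1 + g2) h = star j g1 h + star j g2 h.
Proof. exact: raddfD. Qed.
Lemma star_gen j x y : star j (gen x) y = lstar j x y.
Proof. exact: extend_gen. Qed.

Lemma lstar0Empty x : lstar0 x (gen Empty) = gen x.
Proof. by elim: x => //= a u _ v ->; rewrite graft_gen. Qed.

Lemma lstar1Empty x : lstar1 x (gen Empty) = gen x.
Proof. by elim: x => //= a u _ v ->; rewrite lstar0Empty addrK graft_gen. Qed.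

Lemma starEmptyl j y : star j (gen Empty) y = y.
Proof. by rewrite star_gen /lstar; case: ifP. Qed.

Lemma starEmptyr j g : star j g (gen Empty) = g.
Proof.
elim/free_ind: g => [|g1 g2 IH1 IH2|x]; first by rewrite star0l.
  by rewrite starBl IH1 IH2.
by rewrite star_gen /lstar; case: ifP; rewrite ?lstar0Empty ?lstar1Empty.
Qed.

(** By linearity the recursive formulas hold with arbitrary elements in the
    place of the two subtrees, so that iterated products can be expanded. *)
Lemma star0_graft a g h y : star 0 (graft a g h) y = graft a g (star 0 h y).
Proof.
elim/free_ind: g => [|g1 g2 IH1 IH2|u]; first by rewrite !graft0l star0l.
  by rewrite !graftBl starBl IH1 IH2.
elim/free_ind: h => [|h1 h2 IH1 IH2|v]; first by rewrite !(star0l, graft0r).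
  by rewrite !(starBl, graftBr) IH1 IH2.
by rewrite graft_gen !star_gen.
Qed.

Lemma star1_graft a g h y : star 1 (graft a g h) y =
  graft a g (star 1 h y) + graft a (star 1 g (star 0 h y)) (gen Empty)
  - graft a (star 1 g h) y.
Proof.
elim/free_ind: g => [|g1 g2 IH1 IH2|u].
- by rewrite !(graft0l, star0l) subr0 addr0.
- rewrite !(graftBl, starBl) IH1 IH2.
  exact/esym/addrB3.
elim/free_ind: h => [|h1 h2 IH1 IH2|v].
- by rewrite !(star0l, star0r, graft0r, graft0l) subr0 addr0.
- rewrite !(starBl, starBr, graftBl, graftBr) IH1 IH2.
  exact/esym/addrB3.
by rewrite graft_gen !star_gen.
Qed.

Lemma star0A g h y : star 0 (star 0 g h) y = star 0 g (star 0 h y).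
Proof.
elim/free_ind: g => [|g1 g2 IH1 IH2|x]; first by rewrite !star0l.
  by rewrite !starBl IH1 IH2.
elim: x => [|a u _ v IH]; first by rewrite !starEmptyl.
by rewrite -graft_gen !star0_graft IH.
Qed.

(** For x = Branch a u v, expand both sides: the terms grafted at u agree by
    associativity of *0 together with the induction hypothesis for v, and the
    terms graft a (u *1 (v *0 h)) y cancel. *)
Lemma star_compat g h y :
  star 1 (star 0 g h) y + star 0 (star 1 g h) y = star 0 g (star 1 h y) + star 1 g (star 0 h y).
Proof.
elim/free_ind: g => [|g1 g2 IH1 IH2|x]; first by rewrite !star0l.
  by rewrite !starBl addrACA -opprD IH1 IH2 opprD addrACA.
elim: x => [|a u _ v IH]; first by rewrite !starEmptyl addrC.
rewrite -graft_gen !(star0_graft, star1_graft) starBl starDl !star0_graft starEmptyl star0A.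
have := congr1 (graft a (gen u)) IH; rewrite !graftDr => {}IH.
exact: addr_compat.
Qed.

(** For x = Branch a u v, associativity at u and v reduces the claim to
    the terms of the form graft a (u *1 w) Empty; there the three elements w
    that occur add up correctly exactly by [star_compat] for v, h, y. *)
Lemma star1A g h y : star 1 (star 1 g h) y = star 1 g (star 1 h y).
Proof.
elim/free_ind: g => [|g1 g2 IH1 IH2|x]; first by rewrite !star0l.
  by rewrite !starBl IH1 IH2.
elim: x h y => [|a u IHu v IHv] h y; first by rewrite !starEmptyl.
rewrite -graft_gen !star1_graft starBl starDl !star1_graft !starEmptyl !starEmptyr.
rewrite IHv !IHu.
have := congr1 (fun w => graft a (star 1 (gen u) w) (gen Empty))
  (star_compat (gen v) h y).
rewrite !(starDr, graftDl).
exact: addr_assoc1.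
Qed.

End Algebra.

(** * Functions on monomials that respect the relations *)

Section Relations.
Variables (T : choiceType) (V : zmodType).
Implicit Types (t a b c l r : tree T) (phi : tree T -> V) (j : 'I_2).

Definition comb_eval phi (d : comb T) : V := \sum_(x <- d) phi x.2 *~ x.1.

(** A function on all monomials respects the relations when its linear
    extension factors through the free algebra with two compatible products;
    quantifying over such functions replaces computing in the quotient. *)
Definition respects phi :=
  forall t d, d \in relators t -> comb_eval phi d = 0.

Lemma comb_eval_map phi f d :
  comb_eval phi (comb_map f d) = comb_eval (phi \o f) d.
Proof. exact: big_map. Qed.

Lemma comb_eval_assoc phi j a b c :
  comb_eval phi (assoc_rel j a b c) =
  phi (Node j (Node j a b) c) - phi (Node j a (Node j b c)).
Proof. by rewrite /comb_eval !big_cons big_nil /= addr0 mulr1z mulrN1z. Qed.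

Lemma comb_eval_compat phi a b c :
  comb_eval phi (compat_rel a b c) =
  phi (Node 1 (Node 0 a b) c) + phi (Node 0 (Node 1 a b) c)
  - (phi (Node 0 a (Node 1 b c)) + phi (Node 1 a (Node 0 b c))).
Proof.
by rewrite /comb_eval !big_cons big_nil /= addr0 !mulr1z !mulrN1z -opprD addrA.
Qed.

Lemma respects_assoc phi j a b c : respects phi ->
  phi (Node j (Node j a b) c) = phi (Node j a (Node j b c)).
Proof.
move=> /(_ (Node j (Node j a b) c) (assoc_rel j a b c)) /=.
by rewrite eqxx inE eqxx comb_eval_assoc => /(_ isT)/subr0_eq.
Qed.

Lemma respects_compat phi a b c : respects phi ->
  phi (Node 1 (Node 0 a b) c) + phi (Node 0 (Node 1 a b) c) =
  phi (Node 0 a (Node 1 b c)) + phi (Node 1 a (Node 0 b c)).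
Proof.
move=> /(_ (Node 1 (Node 0 a b) c) (compat_rel a b c)) /=.
by rewrite inE eqxx comb_eval_compat => /(_ isT)/subr0_eq.
Qed.

Lemma respects_Nodel phi j r :
  respects phi -> respects (fun t => phi (Node j t r)).
Proof.
move=> Hphi t d dt; rewrite -[LHS](comb_eval_map phi (fun t => Node j t r)).
by apply: (Hphi (Node j t r)); rewrite /= !mem_cat map_f ?orbT.
Qed.

Lemma respects_Noder phi j l :
  respects phi -> respects (fun t => phi (Node j l t)).
Proof.
move=> Hphi t d dt; rewrite -[LHS](comb_eval_map phi (fun t => Node j l t)).
by apply: (Hphi (Node j l t)); rewrite /= !mem_cat map_f ?orbT.
Qed.

(** The relators are the defining relations in arbitrary contexts, so closure
    of a class under contexts leaves only the relations at the root. *)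
Lemma respects_class (C : (tree T -> V) -> Prop) :
  (forall phi j a b c, C phi ->
     phi (Node j (Node j a b) c) = phi (Node j a (Node j b c))) ->
  (forall phi a b c, C phi ->
     phi (Node 1 (Node 0 a b) c) + phi (Node 0 (Node 1 a b) c) =
     phi (Node 0 a (Node 1 b c)) + phi (Node 1 a (Node 0 b c))) ->
  (forall phi j r, C phi -> C (fun t => phi (Node j t r))) ->
  (forall phi j l, C phi -> C (fun t => phi (Node j l t))) ->
  forall phi, C phi -> respects phi.
Proof.
move=> Cassoc Ccompat Cl Cr phi Cphi t.
elim: t phi Cphi => [//|j l IHl r IHr] phi Cphi d /=.
rewrite !mem_cat => /or3P[|/mapP[e el ->]|/mapP[e er ->]].
- case: l {IHl} => // i a b; rewrite inE => /eqP->.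
  case: eqP => [->|_]; rewrite ?comb_eval_assoc ?comb_eval_compat.
    by rewrite Cassoc ?subrr.
  by rewrite Ccompat ?subrr.
- by rewrite comb_eval_map; apply: IHl el; apply: Cl.
- by rewrite comb_eval_map; apply: IHr er; apply: Cr.
Qed.

End Relations.

(** * Normal forms of monomials *)

Section NormalForms.
Variable T : choiceType.
Implicit Types (t : tree T) (o : option (tree T)) (x y u v : btree T) (j : 'I_2).

Fixpoint nf t : Free (btree T) :=
  match t with
  | Leaf a => gen (Branch a Empty Empty)
  | Node j l r => star j (nf l) (nf r)
  end.

Lemma ord2P (P : 'I_2 -> Prop) : P 0 -> P 1 -> forall j, P j.
Proof.
move=> P0 P1 [[|[|m]] Hm] //.
  by rewrite (_ : Ordinal Hm = 0) //; apply: val_inj.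
by rewrite (_ : Ordinal Hm = 1) //; apply: val_inj.
Qed.

(** Multiplication by a fixed element is additive, so the functions that are
    additive in the normal form are closed under contexts, and at the root
    the relations are the identities satisfied by the two products. *)
Lemma nf_respects (V : zmodType) (f : {additive Free (btree T) -> V}) :
  respects (f \o nf).
Proof.
pose C (phi : tree T -> V) :=
  exists f : {additive Free (btree T) -> V}, phi =1 f \o nf.
apply: (@respects_class _ _ C); last by exists f.
- move=> phi j a b c [{}f Ef]; rewrite !Ef /=; congr (f _).
  elim/ord2P: j; [exact: star0A | exact: star1A].
- by move=> phi a b c [{}f Ef]; rewrite !Ef /= -!raddfD /= star_compat.
- move=> phi j r [{}f Ef].
  have Ha : additive (fun g => f (star j g (nf r))) by move=> g h; rewrite starBl raddfB.
  pose F := GRing.isAdditive.Build _ _ _ Ha.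
  pose f' : {additive _ -> _} := HB.pack (fun g => f (star j g (nf r))) F.
  by exists f' => t; rewrite Ef.
- move=> phi j l [{}f Ef].
  by exists (f \o star j (nf l)) => t; rewrite Ef.
Qed.

(** Multiplication of monomials with a unit adjoined, the unit being [None];
    it avoids a case distinction on which of the subtrees of a normal form
    are empty. *)
Definition onode j o1 o2 :=
  match o1, o2 with
  | Some l, Some r => Some (Node j l r)
  | Some l, None => Some l
  | None, _ => o2
  end.

Fixpoint realize x : option (tree T) :=
  if x is Branch a u v then
    onode 0 (onode 1 (Some (Leaf a)) (realize u)) (realize v)
  else None.

Lemma realize_Branch a u v : realize (Branch a u v) =
  onode 0 (onode 1 (Some (Leaf a)) (realize u)) (realize v).
Proof. by []. Qed.

Definition onf o := if o is Some t then nf t else gen Empty.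

Lemma onf_onode j o1 o2 : onf (onode j o1 o2) = star j (onf o1) (onf o2).
Proof. by case: o1 o2 => [l|] [r|] //=; rewrite ?starEmptyl ?starEmptyr. Qed.

Lemma onf_realize x : onf (realize x) = gen x.
Proof.
elim: x => [//|a u IHu v IHv].
rewrite realize_Branch !onf_onode IHu IHv [onf _]/= -graft_gen star1_graft !starEmptyl addrAC subrr add0r.
by rewrite star0_graft starEmptyl graft_gen.
Qed.

Section Reduction.
Variable V : zmodType.
Implicit Types phi psi : option (tree T) -> V.

Definition orespects phi := respects (phi \o Some).

Lemma orespects_onodel phi j o :
  orespects phi -> orespects (fun o' => phi (onode j o' o)).
Proof. by case: o => [r|] //; apply: respects_Nodel. Qed.

Lemma orespects_onoder phi j o :
  orespects phi -> orespects (fun o' => phi (onode j o o')).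
Proof. by case: o => [r|] //; apply: respects_Noder. Qed.

Lemma orespects_assoc phi j o1 o2 o3 : orespects phi ->
  phi (onode j (onode j o1 o2) o3) = phi (onode j o1 (onode j o2 o3)).
Proof.
by case: o1 o2 o3 => [a|] [b|] [c|] //= Hphi; apply: (respects_assoc j a b c Hphi).
Qed.

(** With a unit among the three arguments both sides consist of the same two
    products, possibly in another order. *)
Lemma orespects_compat phi o1 o2 o3 : orespects phi ->
  phi (onode 1 (onode 0 o1 o2) o3) + phi (onode 0 (onode 1 o1 o2) o3) =
  phi (onode 0 o1 (onode 1 o2 o3)) + phi (onode 1 o1 (onode 0 o2 o3)).
Proof.
case: o1 o2 o3 => [a|] [b|] [c|] //= Hphi; try exact: addrC.
exact: (respects_compat a b c Hphi).
Qed.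

Lemma reduce_graft phi a g h :
  extend (fun x => phi (realize x)) (graft a g h) =
  extend (fun u => extend (fun v => phi (realize (Branch a u v))) h) g.
Proof.
rewrite raddf_extend; apply: eq_extend => u /=.
by rewrite raddf_extend; apply: eq_extend => v /=; rewrite extend_gen.
Qed.

(** The formulas for the products of trees follow from the relations.  The
    proof is by induction on x for all functions phi at once, because the
    induction hypotheses are applied to phi composed with a context. *)
Lemma reduce_lstar phi x j (y : Free (btree T)) : orespects phi ->
  extend (fun z => phi (onode j (realize x) (realize z))) y =
  extend (fun z => phi (realize z)) (lstar j x y).
Proof.
move=> Hphi; elim: x j phi Hphi y => [|a u IHu v IHv] j phi Hphi y.
  by rewrite /lstar /=; case: ifP.
pose H := onode 1 (Some (Leaf a)) (realize u).
have IH0 psi (g : Free (btree T)) : orespects psi ->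
  extend (fun z => psi (onode 0 (realize v) (realize z))) g =
  extend (fun z => psi (realize z)) (lstar0 v g) by move=> Hp; apply: (IHv 0 psi Hp).
have IH1 psi (g : Free (btree T)) : orespects psi ->
  extend (fun z => psi (onode 1 (realize v) (realize z))) g =
  extend (fun z => psi (realize z)) (lstar1 v g) by move=> Hp; apply: (IHv 1 psi Hp).
have IHu1 psi (g : Free (btree T)) : orespects psi ->
  extend (fun z => psi (onode 1 (realize u) (realize z))) g =
  extend (fun z => psi (realize z)) (lstar1 u g) by move=> Hp; apply: (IHu 1 psi Hp).
elim/ord2P: j; rewrite /lstar /=.
  rewrite reduce_graft extend_gen /=.
  rewrite -(IH0 (fun o => phi (onode 0 H o))); last exact: orespects_onoder.
  by apply: eq_extend => z; rewrite orespects_assoc.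
rewrite raddfB raddfD /= !reduce_graft !extend_gen /=.
(* the compatibility relation for a *1 u, v, z, solved for its first term *)
transitivity (extend (fun z => phi (onode 0 H (onode 1 (realize v) (realize z)))
   + phi (onode 1 H (onode 0 (realize v) (realize z)))
   - phi (onode 0 (onode 1 H (realize v)) (realize z))) y).
  by apply: eq_extend => z; rewrite -orespects_compat // addrK.
rewrite extendB extendD; congr (_ + _ - _).
- rewrite -(IH1 (fun o => phi (onode 0 H o))) //; exact: orespects_onoder.
- rewrite (@eq_extend _ _ _ (fun z => phi (onode 1 (Some (Leaf a))
      (onode 1 (realize u) (onode 0 (realize v) (realize z)))))); last first.
    by move=> z; rewrite orespects_assoc.
  rewrite (IH0 (fun o => phi (onode 1 (Some (Leaf a)) (onode 1 (realize u) o)))).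
    rewrite (IHu1 (fun o => phi (onode 1 (Some (Leaf a)) o))) //.
      by apply: eq_extend => z; rewrite extend_gen /=; case: (realize z).
    exact: orespects_onoder.
  exact/(orespects_onoder (phi := fun o => phi (onode 1 (Some (Leaf a)) o)))/orespects_onoder.
- have Hz z : phi (onode 0 (onode 1 H (realize v)) (realize z)) =
     extend (fun w => phi (onode 0 (onode 1 (Some (Leaf a)) (realize w)) (realize z)))
       (lstar1 u (gen v)).
    have Hpsi : orespects (fun o => phi (onode 0 o (realize z))).
      exact: orespects_onodel.
    rewrite -(IHu1 (fun o => phi (onode 0 (onode 1 (Some (Leaf a)) o) (realize z)))).
      rewrite extend_gen.
      exact: (orespects_assoc 1 (Some (Leaf a)) (realize u) (realize v) Hpsi).
    exact: (orespects_onoder 1 (Some (Leaf a)) Hpsi).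
  (* (a *1 u) *1 v is reduced inside the context _ *0 z, one z at a time *)
  rewrite (eq_extend Hz) extend_exchange.
  by apply: eq_extend => w; apply: eq_extend => z.
Qed.

(** Hence the normal forms span: a function that respects the relations is
    determined by its values on them. *)
Lemma reduce phi t : orespects phi ->
  phi (Some t) = extend (fun x => phi (realize x)) (nf t).
Proof.
elim: t phi => [a|j l IHl r IHr] phi Hphi; first by rewrite extend_gen.
have /IHl := orespects_onodel j (Some r) Hphi => /= ->.
rewrite /= /star raddf_extend; apply: eq_extend => x /=.
rewrite -reduce_lstar // -[LHS]/((fun o => phi (onode j (realize x) o)) (Some r)).
exact/IHr/orespects_onoder.
Qed.

End Reduction.
End NormalForms.

(** * Counting binary trees with a given word *)

Section Counting.
Local Open Scope nat_scope.
Variable T : choiceType.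
Implicit Types (x u v : btree T) (w : seq T) (f : seq (btree T)).

Fixpoint word x : seq T :=
  if x is Branch a u v then a :: word u ++ word v else [::].

Definition graft_head a f :=
  if f is u :: v :: f' then Branch a u v :: f' else f.

(** The forests of m trees whose words concatenate to w.  The first tree is
    either empty or has the first letter as its root, and then its two subtrees
    are the first two trees of a forest of m + 1 trees on the other letters. *)
Fixpoint forests w : nat -> seq (seq (btree T)) :=
  if w is a :: w' then
    fix forests_aw' m :=
      if m is m'.+1 then
        map (cons Empty) (forests_aw' m') ++ map (graft_head a) (forests w' m'.+2)
      else [::]
  else fun m => [:: nseq m Empty].

Lemma mem_forests w m f :
  (f \in forests w m) = (size f == m) && (flatten (map word f) == w).
Proof.
elim: w m f => [|a w IHw] m f.
  rewrite /= inE; elim: m f => [|m IHm] [|x f] //=; rewrite !eqseq_cons.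
  by case: x => [|b u v] /=; rewrite ?IHm ?andbF.
elim: m f => [|m IHm] f; first by case: f => [|x f].
rewrite [forests _ _]/= mem_cat; case: f => [|[|b u v] f].
- apply/negbTE; rewrite negb_or; apply/andP; split; apply/mapP => -[//].
  by case=> [|x[|y g]]; rewrite // IHw.
- rewrite mem_map ?IHm => [|? ? []//].
  rewrite [X in _ || X](_ : _ = false) ?orbF //.
  by apply/mapP => -[[|x[|y g]]]; rewrite // IHw.
rewrite (_ : (_ \in map _ _) = false) /=; last by apply/mapP=> -[].
rewrite eqSS eqseq_cons -catA.
have [->|nab] := eqVneq b a; last first.
  rewrite andbF; apply/mapP => -[[|x[|y g]]]; rewrite ?IHw //= => _ [ba].
  by rewrite ba eqxx in nab.
rewrite -[Branch _ _ _ :: f]/(graft_head a (u :: v :: f)).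
apply/mapP/idP => [[[|x[|y g]]]|H]; rewrite ?IHw //.
  by move=> H [-> -> ->].
by exists (u :: v :: f); rewrite ?IHw.
Qed.

Lemma forests_uniq w m : uniq (forests w m).
Proof.
elim: w m => [|a w IHw] //; elim=> [|m IHm] //; rewrite [forests _ _]/=.
rewrite cat_uniq (map_inj_uniq (f := cons Empty)) ?IHm => [/=|? ? []//].
apply/andP; split.
  apply/hasPn => z /mapP[[|x[|y g]]]; rewrite ?mem_forests // => _ ->.
  by apply/mapP => -[].
rewrite map_inj_in_uniq // => f g; rewrite !mem_forests.
case: f g => [|x[|y f]] // [|x'[|y' g]] //=; rewrite ?andbF // => _ _.
by case=> -> -> ->.
Qed.

(** The number of nodes in a position u, where b tells whether the root of the
    tree itself is in such a position.  For b = false it is the number of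
    products *1 in the monomial that the tree stands for. *)
Fixpoint ucount (b : bool) x : nat :=
  if x is Branch _ u v then b + (ucount true u + ucount false v) else 0.

Fixpoint forest_ucount (s : seq bool) f : nat :=
  match s, f with
  | b :: s', x :: f' => ucount b x + forest_ucount s' f'
  | _, _ => 0
  end.

Lemma ucount_le b x : ucount b x <= size (word x).
Proof.
elim: x b => [|a u IHu v IHv] b //=; rewrite size_cat.
by have := IHu true; have := IHv false; case: b; lia.
Qed.

Lemma forest_ucount_le s f : forest_ucount s f <= size (flatten (map word f)).
Proof.
elim: s f => [|b s IH] [|x f] //=; rewrite size_cat.
exact: leq_add (ucount_le b x) (IH f).
Qed.

Definition forest_count w s k :=
  count (fun f => forest_ucount s f == k) (forests w (size s)).

Lemma forest_count_large w s k : size w < k -> forest_count w s k = 0.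
Proof.
move=> wk; apply/eqP; rewrite -leqn0 leqNgt -has_count; apply/hasPn => f.
rewrite mem_forests => /andP[_ /eqP fw]; apply: contraTneq wk => <-.
by rewrite -leqNgt -fw forest_ucount_le.
Qed.

Lemma forest_count_cons a w (b : bool) s k :
  forest_count (a :: w) (b :: s) k =
  forest_count (a :: w) s k
    + (b <= k) * forest_count w [:: true, false & s] (k - b).
Proof.
rewrite {1}/forest_count [forests _ _]/= count_cat !count_map; congr (_ + _).
case: leqP => [bk|kb]; rewrite ?mul1n ?mul0n.
  apply: eq_in_count => -[|u[|v f]]; rewrite mem_forests //= => _.
  by rewrite -!addnA; apply/eqP/eqP; lia.
apply/eqP; rewrite -leqn0 leqNgt -has_count; apply/hasPn.
by case=> [|u[|v f]]; rewrite mem_forests //= => _; apply/eqP; lia.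
Qed.

Definition binp n j := if j is j'.+1 then 'C(n, j') else 0.

Lemma binSp n j : 'C(n.+1, j) = 'C(n, j) + binp n j.
Proof. by case: j => [|j]; rewrite /= ?bin0 // binS. Qed.

(** The determinant formula, written without subtraction.  For w empty only
    j = k = 0 occurs, so the predecessors cause no trouble even if
    p or r is 0. *)
Lemma forest_countE w s j k : j + k = size w ->
  let p := (size w + count negb s).-1 in
  let r := (size w + count id s).-1 in
  forest_count w s k + binp p j * binp r k = 'C(p, j) * 'C(r, k).
Proof.
elim: w s j k => [|a w IHw] s j k.
  case: j k => [|//] [|//] _ /=; rewrite !bin0 addn0 /forest_count /= addn0.
  have : forest_ucount s (nseq (size s) Empty) = 0 by elim: s.
  by move=> ->.
move Dn: (size w) => n; elim: s j k => [|b s IHs] j k /=.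
  rewrite Dn addn0 /forest_count /= add0n; case: j k => [|j] [|k] //= jk.
  - by rewrite (@bin_small n k.+1) ?muln0 //; lia.
  - by rewrite (@bin_small n j.+1) ?muln0 //; lia.
  rewrite -(@bin_sub n j) -1?(@bin_sub n k); try lia.
  by rewrite (_ : n - j = k.+1) 1?(_ : n - k = j.+1) 1?mulnC; lia.
rewrite Dn => jk; rewrite forest_count_cons; have {IHs} := IHs j k.
rewrite /= Dn => /(_ jk).
case: b => /=.
  case: k jk => [|k] jk.
    by rewrite ltn0 mul0n !addn0 !muln0 !bin0 add0n => ->.
  have := IHw [:: true, false & s] j k; rewrite /= Dn subn1 /= mul1n => /(_ _).
  rewrite !add0n !add1n !addnS /= => /(_ ltac:(lia)) H1 H2.
  by rewrite !binSp !mulnDr /=; lia.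
rewrite mul1n subn0 !add0n !add1n !addnS.
case: j jk => [|j] jk.
  by rewrite (@forest_count_large w) ?Dn ?addn0 ?mul0n ?bin0 //; lia.
have := IHw [:: true, false & s] j k; rewrite /= Dn.
rewrite !add0n !add1n !addnS /= => /(_ ltac:(lia)) H1 H2.
by rewrite !binSp !mulnDl /=; lia.
Qed.

Definition word_trees w : seq (btree T) := map (head Empty) (forests w 1).

Lemma mem_word_trees w x : (x \in word_trees w) = (word x == w).
Proof.
apply/mapP/eqP => [[[|y [|z f]]]|<-]; rewrite ?mem_forests //=.
  by rewrite cats0 => /eqP <- ->.
by exists [:: x]; rewrite ?mem_forests //= cats0.
Qed.

Lemma word_trees_uniq w : uniq (word_trees w).
Proof.
rewrite map_inj_in_uniq ?forests_uniq // => f g; rewrite !mem_forests.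
by case: f g => [|x [|? ?]] // [|y [|? ?]] //= _ _ ->.
Qed.

(** One slot of kind v.  Multiplying the determinant by n turns
    C(n - 1, k) and C(n - 1, k - 1) into (k + 1) C(n, k + 1) and k C(n, k),
    and the difference collapses to a single product. *)
Lemma count_word_trees w k : k <= size w -> 0 < size w ->
  size w * count (fun x => ucount false x == k) (word_trees w) =
  'C(size w, k) * 'C(size w, k.+1).
Proof.
case: (size w) (@forest_countE w [:: false] (size w - k) k) => // n H kn _.
have {H} := H (subnK kn); rewrite /= !addn0 addn1 /=.
have -> : forest_count w [:: false] k = count (fun x => ucount false x == k) (word_trees w).
  rewrite count_map; apply: eq_in_count => -[|x [|? ?]]; rewrite mem_forests //= => _.
  by rewrite addn0.
set c := count _ _ => Hc.
have jE : 'C(n.+1, n.+1 - k) = 'C(n.+1, k) by rewrite bin_sub.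
have j1E : binp n.+1 (n.+1 - k) = 'C(n.+1, k.+1).
  have [kn'|nk] := leqP k n; last first.
    by rewrite (_ : n.+1 - k = 0) ?(@bin_small n.+1 k.+1) //; lia.
  by rewrite subSn //= -(@bin_sub n.+1 k.+1) ?subSS.
have kE : n.+1 * 'C(n, k) = k.+1 * 'C(n.+1, k.+1) by rewrite mul_bin_diag.
have k1E : n.+1 * binp n k = k * 'C(n.+1, k).
  by case: (k) => [|k']; rewrite ?muln0 //= mul_bin_diag.
move: (congr1 (muln n.+1) Hc); rewrite jE j1E mulnDr.
rewrite (mulnCA n.+1 _ (binp n k)) k1E (mulnCA n.+1 _ 'C(n, k)) kE; nia.
Qed.

End Counting.

(** * Traces on a quotient of a space of row vectors *)

(** If S and P present the quotient of row vectors by the row space of D, then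
    traces and dimension may be computed with S and P instead of the basis
    chosen by [in_factmod] and [val_factmod].  That the row space of D
    is all of the kernel of P is expressed by [PS]: a matrix that kills D
    factors through P. *)
Section QuotientTrace.
Variables (F : fieldType) (N m : nat) (D : 'M[F]_N).
Variables (S : 'M[F]_(m, N)) (P : 'M[F]_(N, m)).
Hypotheses (SP : S *m P = 1%:M) (DP : D *m P = 0).
Hypothesis PS : forall d (B : 'M[F]_(N, d)), D *m B = 0 -> P *m S *m B = B.

Let V : 'M_(\rank (cokermx D), N) := val_factmod 1%:M.
Let I : 'M_(N, \rank (cokermx D)) := in_factmod D 1%:M.

Lemma factor_iso : (S *m I) *m (V *m P) = 1%:M /\ (V *m P) *m (S *m I) = 1%:M.
Proof.
have inE d (W : 'M_(d, N)) : in_factmod D W = W *m I by rewrite in_factmodE.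
have VI : V *m I = 1%:M by rewrite -inE /V val_factmodK.
have DI : D *m I = 0 by apply/eqP; rewrite -inE in_factmod_eq0.
(* lifting a class back moves a vector only within the row space of D *)
have IVP : I *m V *m P = P.
  have /submxP[W IV] : (I *m V - 1%:M <= D)%MS.
    by rewrite -in_factmod_eq0 inE mulmxBl mul1mx -mulmxA VI mulmx1 subrr.
  have : (I *m V - 1%:M) *m P = 0 by rewrite IV -mulmxA DP mulmx0.
  by rewrite mulmxBl mul1mx => /subr0_eq.
split; first by rewrite mulmxA -(mulmxA S) -(mulmxA S) IVP.
by rewrite mulmxA -(mulmxA V) -mulmxA (PS DI).
Qed.

Lemma factor_dim : \rank (cokermx D) = m.
Proof.
have [AB BA] := factor_iso.
by apply/eqP; rewrite eqn_leq (mulmx1_min AB) (mulmx1_min BA).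
Qed.

Lemma factor_trace (f : 'M[F]_N) : D *m (f *m P) = 0 ->
  \tr (in_factmod D (val_factmod 1%:M *m f) : 'M_(\rank (cokermx D))) =
  \tr (S *m f *m P).
Proof.
move=> DfP; have [AB BA] := factor_iso.
have DI : D *m I = 0 by apply/eqP; rewrite -in_factmodE in_factmod_eq0.
have -> : in_factmod D (val_factmod 1%:M *m f) =
    (V *m P) *m ((S *m f *m P) *m (S *m I)).
  rewrite in_factmodE -/I -/V -{1}(PS DI) -!mulmxA (mulmxA f) -{1}(PS DfP).
  by rewrite -!mulmxA.
by rewrite mxtrace_mulC -(mulmxA _ (S *m I)) AB mulmx1.
Qed.

End QuotientTrace.

(** * A basis of As2(n) *)

Section Leaves.
Variable T : choiceType.
Implicit Types (t : tree T) (x : btree T).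

Lemma relators_leaves t d c : d \in relators t -> c \in d -> leaves c.2 = leaves t.
Proof.
elim: t d c => [//|j l IHl r IHr] d c /=; rewrite !mem_cat.
case/or3P => [|/mapP[e el ->]|/mapP[e er ->]].
- case: l {IHl} => // i a b; rewrite inE => /eqP->.
  by case: eqP => _; rewrite !inE; [case/orP | case/or4P] => /eqP-> /=; rewrite ?catA.
- by case/mapP => c' ce ->; rewrite /= (IHl _ _ el ce).
- by case/mapP => c' ce ->; rewrite /= (IHr _ _ er ce).
Qed.

Definition oleaves (o : option (tree T)) := if o is Some t then leaves t else [::].

Lemma oleaves_onode j o1 o2 : oleaves (onode j o1 o2) = oleaves o1 ++ oleaves o2.
Proof. by case: o1 o2 => [l|] [r|] //=; rewrite cats0. Qed.

Lemma oleaves_realize x : oleaves (realize x) = word x.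
Proof.
elim: x => // a u IHu v IHv; by rewrite realize_Branch !oleaves_onode IHu IHv.
Qed.

Fixpoint btree_map (h : T -> T) x : btree T :=
  if x is Branch a u v then Branch (h a) (btree_map h u) (btree_map h v) else Empty.

Lemma realize_map h x : realize (btree_map h x) = omap (tree_map h) (realize x).
Proof.
elim: x => // a u IHu v IHv; rewrite [btree_map _ _]/= !realize_Branch IHu IHv.
by case: (realize u) (realize v) => [?|] [?|].
Qed.

Lemma word_map h x : word (btree_map h x) = map h (word x).
Proof. by elim: x => //= a u -> v ->; rewrite map_cat. Qed.

End Leaves.

Section Twist.
Variables (F : fieldType) (T : choiceType) (s : T -> T) (g : 'I_2 -> F).

Fixpoint tweight (t : tree T) : F :=
  if t is Node j l r then g j * tweight l * tweight r else 1.

(** Renaming the generators and rescaling each of the two products are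
    automorphisms of the free operad that preserve the relations: the terms
    of one relation contain the same products, hence scale alike. *)
Lemma respects_twist (V : lmodType F) (phi : tree T -> V) : respects phi ->
  respects (fun t => tweight t *: phi (tree_map s t)).
Proof.
move=> Hphi.
pose C (psi : tree T -> V) := exists c phi, respects phi /\
   psi =1 fun t => (c * tweight t) *: phi (tree_map s t).
apply: (@respects_class _ _ C).
- move=> psi j a b d [c [{}phi [{}Hphi E]]]; rewrite !E /= respects_assoc //.
  by congr (_ *: _); ring.
- move=> psi a b d [c [{}phi [{}Hphi E]]]; rewrite !E /=.
  set wa := tweight a; set wb := tweight b; set wd := tweight d.
  pose e := c * g 0 * g 1 * wa * wb * wd.
  have -> : c * (g 1 * (g 0 * wa * wb) * wd) = e by rewrite /e; ring.
  have -> : c * (g 0 * (g 1 * wa * wb) * wd) = e by rewrite /e; ring.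
  have -> : c * (g 0 * wa * (g 1 * wb * wd)) = e by rewrite /e; ring.
  have -> : c * (g 1 * wa * (g 0 * wb * wd)) = e by rewrite /e; ring.
  by rewrite -!scalerDr respects_compat.
- move=> psi j r [c [{}phi [{}Hphi E]]].
  exists (c * g j * tweight r), (fun t => phi (Node j t (tree_map s r))).
  by split; [exact: respects_Nodel | move=> t; rewrite E /=; congr (_ *: _); ring].
- move=> psi j l [c [{}phi [{}Hphi E]]].
  exists (c * g j * tweight l), (fun t => phi (Node j (tree_map s l) t)).
  by split; [exact: respects_Noder | move=> t; rewrite E /=; congr (_ *: _); ring].
by exists 1, phi; split=> // t; rewrite mul1r.
Qed.

End Twist.

Section Component.
Variables (F : fieldType) (n : nat).
Hypothesis n_gt0 : (0 < n)%N.
Implicit Types (t : tree 'I_n) (x : btree 'I_n) (s : 'S_n) (i : 'I_(fdim n)).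

Definition multilinear t := perm_eq (leaves t) (enum 'I_n).

Lemma multilinearP t : reflect (exists i, t = monom i) (multilinear t).
Proof.
apply: (iffP idP) => [ml|[i ->]]; last exact: mtreeP.
by exists (enum_rank (MTree ml)); rewrite /monom enum_rankK.
Qed.

Lemma monom_inj : injective (@monom n).
Proof. by move=> i j /val_inj/enum_val_inj. Qed.

Lemma monom_vec_monom i : monom_vec F (monom i) = delta_mx 0 i.
Proof. by apply/rowP => j; rewrite !mxE eqxx (inj_eq monom_inj). Qed.

Lemma monom_vec_nonmultilinear t : ~~ multilinear t -> monom_vec F t = 0.
Proof.
move=> nml; apply/rowP => j; rewrite !mxE; case: eqP => // jt.
by case/multilinearP: nml; exists j.
Qed.

Lemma mul_monom_vec d (B : 'M[F]_(_, d)) i : monom_vec F (monom i) *m B = row i B.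
Proof. by rewrite monom_vec_monom rowE. Qed.

Lemma comb_vec_mul d (B : 'M[F]_(_, d)) (r : comb 'I_n) :
  comb_vec F r *m B = comb_eval (fun t => monom_vec F t *m B) r.
Proof.
rewrite mulmx_suml; apply: eq_bigr => c _.
by rewrite -scalemxAl scaler_int.
Qed.

Lemma eq_comb_eval (V : zmodType) (phi psi : tree 'I_n -> V) t r :
  r \in relators t -> (forall t', leaves t' = leaves t -> phi t' = psi t') ->
  comb_eval phi r = comb_eval psi r.
Proof.
move=> rt e; rewrite /comb_eval !big_seq; apply: eq_bigr => c cr.
by rewrite e // (relators_leaves rt cr).
Qed.

(** Row vectors exist only for multilinear monomials; on the others the
    function below is 0, and the relators respect this dichotomy because all
    their terms have the same leaves. *)
Lemma respects_of_ideal d (B : 'M[F]_(_, d)) :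
  ideal F n *m B = 0 -> respects (fun t => monom_vec F t *m B).
Proof.
move=> iB t r rt; have [ml|nml] := boolP (multilinear t); last first.
  rewrite (eq_comb_eval (psi := fun => 0) rt) => [|t' e].
    by rewrite /comb_eval big1 // => c _; rewrite mul0rz.
  by rewrite monom_vec_nonmultilinear ?mul0mx // /multilinear e.
rewrite -comb_vec_mul; apply/sub_kermxP.
apply: submx_trans (_ : ideal F n <= _)%MS; last exact/sub_kermxP.
rewrite /ideal (bigD1 (MTree ml)) //= (big_rem r) //=.
by rewrite -addsmxA (submx_trans _ (addsmxSl _ _)) ?genmxE.
Qed.

Lemma ideal_of_respects d (B : 'M[F]_(_, d)) (psi : tree 'I_n -> 'rV[F]_d) :
  respects psi -> (forall i, row i B = psi (monom i)) -> ideal F n *m B = 0.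
Proof.
move=> resp rB; apply/sub_kermxP/sumsmx_subP => t _.
rewrite big_seq; elim/big_rec: _ => [|r A rt Ak]; first exact: sub0mx.
rewrite addsmx_sub Ak genmxE andbT; apply/sub_kermxP.
rewrite comb_vec_mul (eq_comb_eval (psi := psi) rt) ?(resp _ _ rt) // => t' e.
have /multilinearP[i ->] : multilinear t' by rewrite /multilinear e mtreeP.
by rewrite mul_monom_vec rB.
Qed.

Definition normals : seq (btree 'I_n) :=
  [seq x | w <- permutations (enum 'I_n), x <- word_trees w].

Lemma mem_normals x : (x \in normals) = perm_eq (word x) (enum 'I_n).
Proof.
apply/allpairsPdep/idP => [[w [y [wp yw ->]]]|xp].
  by move: wp yw; rewrite mem_permutations mem_word_trees => wp /eqP->.
by exists (word x), x; rewrite mem_permutations mem_word_trees.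
Qed.

Lemma normals_uniq : uniq normals.
Proof.
apply: allpairs_uniq_dep => [|w _|]; rewrite ?permutations_uniq ?word_trees_uniq //.
move=> _ _ /allpairsPdep[w [x [_ xw ->]]] /allpairsPdep[w' [x' [_ xw' ->]]] /= e.
by move: xw xw'; rewrite !mem_word_trees -e => /eqP-> /eqP->.
Qed.

Lemma realize_normal x : x \in normals ->
  exists2 i, realize x = Some (monom i) & nf (monom i) = gen x.
Proof.
rewrite mem_normals => xp; case Ex: (realize x) (oleaves_realize x) (onf_realize x) => [t|] /= lt.
  have /multilinearP[i ->] : multilinear t by rewrite /multilinear lt.
  by exists i.
by have := perm_size xp; rewrite -lt size_enum_ord => n0; have := n_gt0; rewrite -[in (0 < n)%N]n0.
Qed.

Definition ovec (o : option (tree 'I_n)) : 'rV[F]_(fdim n) :=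
  if o is Some t then monom_vec F t else 0.

Lemma ovec_nonnormal x : x \notin normals -> ovec (realize x) = 0.
Proof.
rewrite mem_normals; case: (realize x) (oleaves_realize x) => //= t <-.
exact: monom_vec_nonmultilinear.
Qed.

Let m := size normals.
Let normal (j : 'I_m) := nth Empty normals j.

Definition normal_mx : 'M[F]_(m, fdim n) := \matrix_j ovec (realize (normal j)).

Definition coef_row (g : Free (btree 'I_n)) : 'rV[F]_m :=
  \row_j (coef (normal j) g)%:~R.

Definition nf_mx : 'M[F]_(fdim n, m) := \matrix_i coef_row (nf (monom i)).

Lemma coef_row_is_additive : additive coef_row.
Proof. by move=> g h; apply/rowP => j; rewrite !mxE raddfB rmorphB. Qed.
HB.instance Definition _ :=
  GRing.isAdditive.Build (Free (btree 'I_n)) 'rV[F]_m coef_row coef_row_is_additive.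

Lemma mem_normal j : normal j \in normals.
Proof. exact: mem_nth. Qed.

Lemma monom_vec_nf_mx t : multilinear t -> monom_vec F t *m nf_mx = coef_row (nf t).
Proof. by case/multilinearP=> i ->; rewrite mul_monom_vec rowK. Qed.

Lemma coef_row_gen (j : 'I_m) : coef_row (gen (normal j)) = delta_mx 0 j.
Proof.
apply/rowP => l; rewrite !mxE coef_basis nth_uniq ?normals_uniq //= val_eqE.
by rewrite rmorph_nat.
Qed.

Lemma normal_mx_nf_mx : normal_mx *m nf_mx = 1%:M.
Proof.
apply/row_matrixP => j; rewrite row_mul rowK row1.
have [i -> e] := realize_normal (mem_normal j).
by rewrite mul_monom_vec rowK e coef_row_gen.
Qed.

(** By [reduce], a linear function that vanishes on the ideal is recovered from
    its values on the normal forms. *)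
Lemma nf_mx_normal_mxK d (B : 'M[F]_(fdim n, d)) :
  ideal F n *m B = 0 -> nf_mx *m normal_mx *m B = B.
Proof.
move=> /respects_of_ideal resp; apply/row_matrixP => i.
pose phi o := ovec o *m B.
have := @reduce _ _ phi (monom i) resp; rewrite /phi /= mul_monom_vec => ->.
rewrite (extendEw normals_uniq) => [|x xn]; last first.
  by rewrite ovec_nonnormal // mul0mx mul0rz.
rewrite -mulmxA row_mul rowK (big_nth Empty) big_mkord mulmx_sum_row.
apply: eq_bigr => j _; rewrite mxE row_mul rowK scaler_int //.
Qed.

Lemma ideal_nf_mx : ideal F n *m nf_mx = 0.
Proof.
apply: (@ideal_of_respects _ nf_mx (coef_row \o @nf _)); first exact: nf_respects.
by move=> i; rewrite rowK.
Qed.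

Lemma multilinear_map s t : multilinear t -> multilinear (tree_map s t).
Proof.
move=> ml; have -> : multilinear (tree_map s t) =
    perm_eq (map s (leaves t)) (enum 'I_n).
  congr perm_eq; elim: {ml} t => //= j l -> r ->; exact/esym/map_cat.
apply: uniq_perm; rewrite ?enum_uniq //.
  by rewrite (map_inj_uniq perm_inj) (perm_uniq ml) enum_uniq.
move=> i; rewrite mem_enum -(permKV s i) (mem_map perm_inj).
by rewrite (perm_mem ml) mem_enum.
Qed.

(** Any endomorphism f that renames the generators by s and scales a monomial
    by its weight; both the action of permutations and that of the torus are of
    this form. *)
Section Trace.
Variables (f : 'M[F]_(fdim n)) (s : 'S_n) (g : 'I_2 -> F).
Hypothesis fE : forall i,
  row i f = tweight g (monom i) *: monom_vec F (tree_map s (monom i)).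

Lemma mul_monom_vec_nf t : multilinear t ->
  monom_vec F t *m f *m nf_mx = tweight g t *: coef_row (nf (tree_map s t)).
Proof.
move=> ml; have := multilinear_map s ml; case/multilinearP: ml => i -> sml.
by rewrite mul_monom_vec fE -scalemxAl monom_vec_nf_mx.
Qed.

Lemma ideal_twist : ideal F n *m (f *m nf_mx) = 0.
Proof.
apply: ideal_of_respects (respects_twist s g (nf_respects coef_row)) _ => i.
by rewrite row_mul -mul_monom_vec mul_monom_vec_nf //; exact: mtreeP.
Qed.

(** Permutations act freely on normal forms, since the labels of a normal form
    exhaust the generators and occur in a fixed order. *)
Lemma btree_map_normal x : x \in normals -> (btree_map s x == x) = (s == 1%g).
Proof.
rewrite mem_normals => xp; apply/eqP/eqP => [sx|->].
  apply/permP => i; rewrite perm1.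
  have : map s (word x) = map id (word x) by rewrite map_id -[RHS](congr1 (@word _) sx) word_map.
  by move/eq_in_map; apply; rewrite (perm_mem xp) mem_enum.
by elim: {xp} x => //= a u -> v ->; rewrite perm1.
Qed.

Definition normal_weight x := if realize x is Some t then tweight g t else 1.

Lemma twist_trace :
  \tr (as2_mx f) = (s == 1%g)%:R * \sum_(x <- normals) normal_weight x.
Proof.
rewrite (factor_trace normal_mx_nf_mx ideal_nf_mx nf_mx_normal_mxK ideal_twist).
rewrite (big_nth Empty) big_mkord mulr_sumr; apply: eq_bigr => j _.
have /= jn := mem_normal j.
have [i ri nfi] := realize_normal jn.
have : row j (normal_mx *m f *m nf_mx) 0 j = (s == 1%g)%:R * normal_weight (normal j).
  rewrite !row_mul rowK ri /= mul_monom_vec_nf; last exact: mtreeP.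
  rewrite !mxE /normal_weight ri mulrC; congr (_ * _).
  have := onf_realize (btree_map s (normal j)); rewrite realize_map ri /= => ->.
  by rewrite coef_basis eq_sym btree_map_normal // rmorph_nat.
by rewrite mxE.
Qed.

End Trace.

Lemma as2_dimE : as2_dim F n = size normals.
Proof. exact: (factor_dim normal_mx_nf_mx ideal_nf_mx nf_mx_normal_mxK). Qed.

End Component.

(** * Characters of As2(n) *)

Section Characters.
Variables (F : fieldType) (n : nat).
Hypothesis n_gt0 : (0 < n)%N.
Implicit Types (s : 'S_n) (t : tree 'I_n) (x : btree 'I_n).

Lemma tweight1 t : tweight (fun=> 1 : F) t = 1.
Proof. by elim: t => //= j l -> r ->; rewrite !mul1r. Qed.

Lemma eq_tweight (g h : 'I_2 -> F) t : g =1 h -> tweight g t = tweight h t.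
Proof. by move=> e; elim: t => //= j l -> r ->; rewrite e. Qed.

Lemma tweight_map (g : 'I_2 -> F) (h : 'I_n -> 'I_n) t :
  tweight g (tree_map h t) = tweight g t.
Proof. by elim: t => //= j l -> r ->. Qed.

Lemma gl_coef_diag (d : 'rV[F]_2) t t' :
  gl_coef (diag_mx d) t t' = tweight (d 0) t *+ (t' == t).
Proof.
elim: t t' => [a|j l IHl r IHr] [b|j' l' r'];
  rewrite [gl_coef _ _ _]/= [tweight _ _]/=.
- rewrite (_ : (Leaf b == Leaf a) = (b == a)) ?[b == a]eq_sym //.
  by apply/eqP/eqP => [[]|->].
- by rewrite (_ : (_ == _) = false) //; apply/eqP.
- by rewrite (_ : (_ == _) = false) //; apply/eqP.
rewrite IHl IHr !mxE; case: (eqVneq (Node j' l' r') (Node j l r)) => [[-> -> ->]|ne].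
  by rewrite !eqxx.
case: eqP => [ej|_]; last by rewrite mulr0n !mul0r.
case: eqP => [el|_]; last by rewrite mulr0n mulr0 mul0r.
case: eqP => [er|_]; last by rewrite mulr0n mulr0.
by rewrite ej el er eqxx in ne.
Qed.

Lemma as2_charE s : as2_char F s = (s == 1%g)%:R * (size (normals n))%:R.
Proof.
have fE i : row i (perm_act F s) =
    tweight (fun=> 1) (monom i) *: monom_vec F (tree_map s (monom i)).
  by rewrite tweight1 scale1r; apply/rowP => j; rewrite !mxE.
rewrite [LHS](twist_trace n_gt0 fE); congr (_ * _).
rewrite -[size _]sum1_size natr_sum; apply: eq_bigr => x _.
by rewrite /normal_weight; case: (realize x) => // t; rewrite tweight1.
Qed.

Lemma as2_char_SL2E s (q : F) : as2_char_SL2 s (torus q) =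
  (s == 1%g)%:R * \sum_(x <- normals n)
     normal_weight (fun j : 'I_2 => if j == 0 then q else q^-1) x.
Proof.
apply: (twist_trace n_gt0) => i.
rewrite row_mul.
have -> : row i (perm_act F s) = monom_vec F (tree_map s (monom i)).
  by apply/rowP => j; rewrite !mxE.
have /multilinearP[l e] := multilinear_map s (mtreeP (enum_val i)).
rewrite /monom in e *; rewrite e mul_monom_vec -(tweight_map _ s) e.
apply/rowP => j; rewrite !mxE gl_coef_diag [RHS]mulr_natr; congr (_ *+ _).
by apply: eq_tweight => b; rewrite mxE.
Qed.

Lemma normal_weight_Branch (g : 'I_2 -> F) (a : 'I_n) (u v : btree 'I_n) :
  normal_weight g (Branch a u v) =
  (if u is Empty then 1 else g 1 * normal_weight g u)
  * (if v is Empty then 1 else g 0 * normal_weight g v).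
Proof.
have realizeN x : realize x = None -> x = Empty.
  by case: x => // b y z; rewrite realize_Branch; case: (realize y) (realize z) => [?|] [?|].
rewrite /normal_weight realize_Branch.
case: u => [|b u1 u2]; case: v => [|c v1 v2] //.
- by rewrite /= mul1r.
- case: (realize (Branch c v1 v2)) (realizeN (Branch c v1 v2)) => [t|/(_ erefl)//] _.
  by rewrite /= mulr1 mul1r.
- case: (realize (Branch b u1 u2)) (realizeN (Branch b u1 u2)) => [t|/(_ erefl)//] _.
  by rewrite /= !mulr1.
case: (realize (Branch b u1 u2)) (realizeN (Branch b u1 u2)) => [t|/(_ erefl)//] _.
case: (realize (Branch c v1 v2)) (realizeN (Branch c v1 v2)) => [t'|/(_ erefl)//] _.
by rewrite /= mulr1 [g 0 * _]mulrC mulrAC -mulrA [g 0 * _]mulrC.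
Qed.

(** Every node but the root contributes one product: *1, of weight q^-1, in a
    position u, and *0, of weight q, in a position v.  With the
    root counted in a position v, a tree with n nodes has total weight
    q^(n - 2 k), which exceeds the true weight by one factor q. *)
Lemma normal_weightE (q : F) x : q != 0 -> x != Empty ->
  normal_weight (fun j : 'I_2 => if j == 0 then q else q^-1) x =
  q ^ ((size (word x))%:Z - 1 - (ucount false x).*2%:Z).
Proof.
move=> q0; set g := fun j : 'I_2 => _.
have ucount_true y : y != Empty -> ucount true y = (ucount false y).+1 by case: y.
elim: x => // a u IHu v IHv _; rewrite normal_weight_Branch.
have -> : (if u is Empty then 1 else g 1 * normal_weight g u) =
    q ^ ((size (word u))%:Z - (ucount true u).*2%:Z).
  case: u IHu => // b u1 u2 /(_ isT) ->; rewrite ucount_true // -[g 1]/(q^-1).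
  by rewrite -exprN1 -expfzDr //; congr (q ^ _); lia.
have -> : (if v is Empty then 1 else g 0 * normal_weight g v) =
    q ^ ((size (word v))%:Z - (ucount false v).*2%:Z).
  case: v IHv => // b v1 v2 /(_ isT) ->.
  by rewrite -[g 0]/q -{1}[q]expr1z -expfzDr //; congr (q ^ _); lia.
by rewrite -expfzDr //= size_cat; congr (q ^ _); lia.
Qed.

End Characters.

(** * Narayana and Catalan sums *)

Section Generating.
Variables (A : fieldType) (char0 : [pchar A] =i pred0) (n : nat).
Hypothesis n_gt0 : (0 < n)%N.

Lemma natr_neq0 k : (0 < k)%N -> k%:R != 0 :> A.
Proof. by move/pcharf0P: char0 => ->; rewrite -lt0n. Qed.

Lemma sum_word_trees (G : nat -> A) (w : seq 'I_n) : size w = n ->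
  \sum_(x <- word_trees w) G (ucount false x) = \sum_(0 <= k < n) narayana A n k * G k.
Proof.
move=> wn; have n0 := natr_neq0 n_gt0.
have cE k : (k <= n)%N ->
    (count (fun x => ucount false x == k) (word_trees w))%:R = narayana A n k.
  move=> kn; apply: (mulfI n0).
  have := @count_word_trees _ w k; rewrite wn -natrM => -> //.
  by rewrite /narayana -!mulrA mulVKf // natrM.
rewrite (eq_big_seq (fun x => \sum_(0 <= k < n.+1) (ucount false x == k)%:R * G k)).
  transitivity (\sum_(0 <= k < n.+1) narayana A n k * G k).
    rewrite exchange_big !big_nat; apply: eq_bigr => k /andP[_ kn].
    rewrite -mulr_suml -cE //; congr (_ * _).
    rewrite -sum1_count natr_sum [RHS]big_mkcond.
    by apply: eq_bigr => x _; case: eqP.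
  (* k = n does not occur: C(n, n + 1) = 0 *)
  rewrite big_nat_recr //= [X in _ + X](_ : _ = 0) ?addr0 //.
  by rewrite /narayana (@bin_small n n.+1) // mulr0 mul0r.
move=> x; rewrite mem_word_trees => /eqP xw.
have ux : (ucount false x < n.+1)%N by rewrite ltnS -[leqRHS]wn -xw ucount_le.
rewrite (bigD1_seq (ucount false x)) ?iota_uniq ?mem_index_iota //= eqxx mul1r.
by rewrite big1 ?addr0 // => k /negbTE; rewrite eq_sym => ->; rewrite mul0r.
Qed.

(** The number of trees depends on the word only through its length, and n
    generators have n! words. *)
Lemma sum_normals (G : nat -> A) :
  \sum_(x <- normals n) G (ucount false x) =
  n`!%:R * \sum_(0 <= k < n) narayana A n k * G k.
Proof.
rewrite big_allpairs_dep.
rewrite (eq_big_seq (fun=> \sum_(0 <= k < n) narayana A n k * G k)).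
  rewrite big_const_seq iter_addr_0 count_predT size_permutations ?enum_uniq //.
  by rewrite size_enum_ord mulr_natl.
move=> w; rewrite mem_permutations => /perm_size; rewrite size_enum_ord.
exact: sum_word_trees.
Qed.

Lemma sum_narayana : \sum_(0 <= k < n) narayana A n k = catalan A n.
Proof.
have n0 := natr_neq0 n_gt0; have n1 := natr_neq0 (ltn0Sn n).
have E : (\sum_(0 <= k < n) 'C(n, k) * 'C(n, k.+1) = 'C(n.*2, n.-1))%N.
  rewrite -addnn -(binomial.Vandermonde n n n.-1) prednK // big_mkord.
  apply: eq_bigr => k _; rewrite -(@bin_sub n k.+1) //.
  by congr (_ * 'C(_, _))%N; have := ltn_ord k; lia.
have C : (n.+1 * 'C(n.*2, n.-1) = n * 'C(n.*2, n))%N.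
  have := mul_bin_left n.*2 n.-1; rewrite (prednK n_gt0) => ->; congr (_ * _)%N.
  by case: n n_gt0 => // n' _ /=; rewrite -addnn; lia.
apply: (mulfI n0); rewrite mulr_sumr.
under eq_bigr do rewrite /narayana -!mulrA mulVKf // -natrM.
rewrite -natr_sum E; apply: (mulfI n1).
by rewrite -natrM C /catalan natrM mulrCA; congr (_ * _); rewrite mulVKf.
Qed.

Lemma size_normals : (size (normals n))%:R = n`!%:R * catalan A n.
Proof.
rewrite -sum1_size natr_sum (sum_normals (fun=> 1)) -sum_narayana.
by congr (_ * _); apply: eq_bigr => k _; rewrite mulr1.
Qed.

End Generating.

(** * Generating functions *)

(** When the n-th terms live in degree n, the series has at each index i at most
    one nonzero term, the one of degree deg i. *)
Lemma fsum_eq_graded (I : Type) (V : nmodType) (u v : nat -> I -> V) (deg : I -> nat) :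
  (forall n, (0 < n)%N -> u n =1 v n) ->
  (forall n i, n != deg i -> v n i = 0) -> fsum_eq u v.
Proof.
move=> uv vdeg; pose S i := if (0 < deg i)%N then v (deg i) i else 0.
have vS : fsum v S.
  move=> i; exists (deg i).+1 => M iM; rewrite /S.
  case: ifP => [d0|d0].
    rewrite (bigD1_seq (deg i)) ?iota_uniq ?mem_index_iota ?d0 //=.
    by rewrite big1 ?addr0 // => n /vdeg.
  rewrite big_nat big1 // => n /andP[n0 _]; apply: vdeg.
  by apply: contraTneq n0 => ->; rewrite d0.
exists S; split=> // i; have [N HN] := vS i; exists N => M /HN <-.
by rewrite !big_nat; apply: eq_bigr => n /andP[n0 _]; apply: uv.
Qed.

Lemma malgUM (A : fieldType) (a b : {cmonom nat}) :
  (<< a >> : ppoly A) * << b >> = << mmul a b >>.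
Proof. by have := @fgmulUU _ A 1 1 a b; rewrite mulr1 => <-; apply: malgM_def. Qed.

Section Frobenius.
Variable A : fieldType.

Lemma pcoef_p1X (c : A) (n : nat) (m : {cmonom nat}) :
  n != m 1%N -> pcoef (c *: p_ A 1 ^+ n) m = 0.
Proof.
move=> nm; rewrite /pcoef mcoeffZ.
have [e en ->] : exists2 e : {cmonom nat}, e 1%N = n & p_ A 1 ^+ n = << e >>.
  elim: {nm} n => [|n [e en E]]; first by exists mone; rewrite ?cm1.
  exists (mmul (ucm 1%N) e); first by rewrite cmM cmUU en.
  by rewrite exprS E; apply: malgUM.
by rewrite mcoeffU1; case: eqP => [em|]; rewrite ?mulr0 //; rewrite -en em eqxx in nm.
Qed.

Lemma ncycles1 (n i : nat) : ncycles (1 : 'S_n)%g i = if i == 1%N then n else 0%N.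
Proof.
have orb (x : 'I_n) : porbit 1%g x = [set x].
  apply/setP => y; rewrite inE; apply/porbitP/eqP => [[j ->]|->].
    by rewrite expg1n perm1.
  by exists 0%N; rewrite expg0 perm1.
rewrite /ncycles; case: eqP => [->|i1].
  rewrite (_ : [set C in _ | _] = porbits 1%g).
    rewrite card_imset ?card_ord // => x y; rewrite !orb.
    exact: set1_inj.
  by apply/setP => C; rewrite inE andb_idr // => /imsetP[x _ ->]; rewrite orb cards1.
apply/eqP; rewrite cards_eq0; apply/eqP/setP => C; rewrite !inE.
apply/negbTE; apply/negP => /andP[/imsetP[x _ ->]]; rewrite orb cards1 => /eqP e.
by rewrite e in i1.
Qed.

Lemma frob_regular (n : nat) (chi : 'S_n -> A) (c : A) : (0 < n)%N -> n`!%:R != 0 :> A ->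
  (forall s, chi s = (s == 1%g)%:R * (n`!%:R * c)) ->
  frob chi = c *: p_ A 1 ^+ n.
Proof.
move=> n0 nf chiE.
pose B (s : 'S_n) : ppoly A := \prod_(1 <= i < n.+1) p_ A i ^+ ncycles s i.
have B1 : B 1%g = p_ A 1 ^+ n.
  rewrite /B big_ltn // ncycles1 big_nat big1 => [|i /andP[i1 _]]; first exact: mulr1.
  by rewrite ncycles1 gtn_eqF.
have sumB : \sum_(s : 'S_n) chi s *: B s = (n`!%:R * c) *: B 1%g.
  rewrite (bigD1 1%g) // big1 => [|s /negbTE s1]; last by rewrite chiE s1 mul0r scale0r.
  by rewrite chiE eqxx mul1r; apply: addr0.
rewrite -[frob chi]/((n`!%:R)^-1 *: \sum_(s : 'S_n) chi s *: B s) sumB B1.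
have e : n`!%:R^-1 * (n`!%:R * c) = c by rewrite (mulKf nf).
by rewrite -[in RHS]e; apply: scalerA.
Qed.

End Frobenius.

Lemma lval_sum (k A : fieldType) (f : {rmorphism k -> A}) (q : A)
    (I : Type) (r : seq I) (z : I -> int) :
  lval f q (\sum_(x <- r) << z x >>) = \sum_(x <- r) q ^ z x.
Proof.
rewrite -[lval f q]/(mmap f (fun j => q ^ j)) raddf_sum.
by apply: eq_bigr => x _; rewrite /= mmapU -[RHS]mul1r; congr (_ * _); apply: rmorph1.
Qed.

(** The trace on As2(n) as a Laurent polynomial: each normal form contributes
    the exponent n - 1 - 2 k of its weight. *)
Definition torus_char (k : fieldType) (n : nat) (s : 'S_n) : laurent k :=
  if s == 1%g then
    \sum_(x <- normals n) << n%:Z - 1 - (ucount false x).*2%:Z >>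
  else 0.

Lemma lval_torus_char (k A : fieldType) (f : {rmorphism k -> A}) (q : A) n (s : 'S_n) :
  lval f q (torus_char k s) =
  (s == 1%g)%:R * \sum_(x <- normals n) q ^ (n%:Z - 1 - (ucount false x).*2%:Z).
Proof.
rewrite /torus_char; case: eqP => _; first by rewrite lval_sum mul1r.
by rewrite mul0r -[lval f q]/(mmap f (fun j => q ^ j)) raddf0.
Qed.

Lemma lval_torus_charE (k : fieldType) (n : nat) (s : 'S_n) (q : k) :
  (0 < n)%N -> q != 0 ->
  lval id q (torus_char k s) = as2_char_SL2 s (torus q).
Proof.
move=> n0 q0; rewrite as2_char_SL2E // (lval_torus_char idfun).
congr (_ * _); apply: eq_big_seq => x; rewrite mem_normals => xp.
have wx : size (word x) = n by rewrite (perm_size xp) size_enum_ord.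
rewrite normal_weightE // ?wx //.
by apply: contraTneq n0 => x0; rewrite -[in X in (0 < X)%N]wx x0.
Qed.

Lemma as2_dim_catalan (k : fieldType) (n : nat) : (0 < n)%N ->
  (as2_dim k n)%:R / n`!%:R = catalan rat n.
Proof.
move=> n0; have charQ := Num.Theory.pchar_num rat.
rewrite as2_dimE // (size_normals charQ) // mulrAC mulfV ?mul1r //.
by rewrite natr_neq0 ?fact_gt0.
Qed.

Theorem theorem2 (k : fieldType) (char0 : [pchar k] =i pred0) :
  [/\ fsum_eq
        (fun n i => (((as2_dim k n)%:R / n`!%:R) *: 'X^n : {poly rat})`_i)
        (fun n i => (catalan rat n *: 'X^n : {poly rat})`_i),
      fsum_eq
        (fun n => pcoef (frob (as2_char k (n := n))))
        (fun n => pcoef (catalan k n *: p_ k 1 ^+ n))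
    & exists2 L : forall n : nat, 'S_n -> laurent k,
        forall (n : nat) (s : 'S_n) (q : k), (0 < n)%N -> q != 0 ->
          lval id q (L n s) = as2_char_SL2 s (torus q)
      & fsum_eq
          (fun n => pcoef (frob (fun s : 'S_n => laurent_rf (L n s))))
          (fun n => pcoef
             ((\sum_(0 <= j < n)
                 narayana (ratfun k) n j * rf_q k ^ (n%:Z - 1 - (j.*2)%:Z))
              *: p_ (ratfun k) 1 ^+ n))].
Proof.
have charK : [pchar ratfun k] =i pred0.
  by move=> p; rewrite (fmorph_pchar (@tofrac {poly k} \o polyC : {rmorphism k -> ratfun k})).
split.
- apply: (fsum_eq_graded (deg := id)) => [n n0 i|n i ni].
    by rewrite as2_dim_catalan.
  by rewrite coefZ coefXn eq_sym (negbTE ni) mulr0.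
- apply: (fsum_eq_graded (deg := fun m : {cmonom nat} => m 1%N)) => [n n0 m|n m].
    rewrite (frob_regular (c := catalan k n)) ?natr_neq0 ?fact_gt0 // => s.
    by rewrite as2_charE // size_normals.
  exact: pcoef_p1X.
exists (torus_char k); first by move=> n s q; apply: lval_torus_charE.
apply: (fsum_eq_graded (deg := fun m : {cmonom nat} => m 1%N)) => [n n0 m|n m].
  have nf : n`!%:R != 0 :> ratfun k := natr_neq0 charK (fact_gt0 n).
  have sumE := sum_normals charK n0 (fun j => rf_q k ^ (n%:Z - 1 - j.*2%:Z)).
  have chiE (s : 'S_n) := lval_torus_char (@tofrac {poly k} \o polyC) (rf_q k) s.
  have charE s := etrans (chiE s) (congr1 ( *%R (s == 1%g)%:R) sumE).
  exact: (congr1 (fun P => pcoef P m) (frob_regular n0 nf charE)).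
exact: pcoef_p1X.
Qed.
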